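(* Let $\mathcal{A}_i$ be an optimal active set of the multiparametric quadratic program (mpQP), with complement $\mathcal{N}_i$, and let the parametric solution for $\mathcal{A}_i$ be $\lambda^*(\theta)=\tilde q_i+\tilde Q_i\theta$, $z^*(\theta)=k_i+K_i\theta$. Let $l\in\mathcal{N}_i$ be such that $\mathcal{A}_j=\mathcal{A}_i\cup\{l\}$ is also an optimal active set, with complement $\mathcal{N}_j$. Assume $G_{\mathcal{A}_i}$ and $G_{\mathcal{A}_j}$ have full row rank. Then there exist $c_j\in\mathbb{R}$, $v_j\in\mathbb{R}^{n}$, $f_j\in\mathbb{R}^{m}$ and $\tilde d_j\in\mathbb{R}^{p}$ with $\tilde d_{j,\mathcal{N}_j}=0$ and $\tilde d_{j,l}=-1$ (the entries $\tilde d_{j,\mathcal{A}_i}$ being possibly non-zero), such that the parametric solution for $\mathcal{A}_j$ is given, for all $\theta\in\mathbb{R}^n$, by $$\lambda^*(\theta)=\tilde q_j+\tilde Q_j\theta=\tilde q_i+\tilde Q_i\theta-\tilde d_j\,(c_j+v_j^T\theta),$$ $$z^*(\theta)=k_j+K_j\theta=k_i+K_i\theta+f_j\,(c_j+v_j^T\theta).$$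
   Context: Problem (mpQP): for a parameter $\theta\in\Theta\subseteq\mathbb{R}^n$ ($\Theta$ a polyhedral set), minimize $\frac12 z^T H z$ over $z\in\mathbb{R}^m$ subject to $Gz\preceq b+S\theta$, where $H\in\mathbb{R}^{m\times m}$ is symmetric positive definite, $G\in\mathbb{R}^{p\times m}$, $b\in\mathbb{R}^p$, $S\in\mathbb{R}^{p\times n}$, and $\preceq$ is componentwise. Lagrange multipliers of the inequalities are denoted $\lambda\in\mathbb{R}^p$ (KKT conditions: $Hz+G^T\lambda=0$, $Gz\preceq b+S\theta$, $\lambda\succeq0$, complementary slackness). Indexing: for an index set $\mathcal{I}\subseteq\{1,\dots,p\}$, $G_{\mathcal{I}}$, $b_{\mathcal{I}}$, $S_{\mathcal{I}}$ denote the rows indexed by $\mathcal{I}$; for indexed quantities such as $\tilde q_i,\tilde Q_i,\tilde d_j$, a second index denotes the corresponding entries or rows, e.g. $\tilde q_{i,\mathcal{I}}$. Optimal active set: a set $\mathcal{A}\subseteq\{1,\dots,p\}$ that, for some $\theta\in\Theta$ for which the problem is feasible, is exactly the set of constraints holding with equality at the optimum, with no weakly active constraints (the multipliers indexed by $\mathcal{A}$ are nonzero). Its complement is $\mathcal{N}=\{1,\dots,p\}\setminus\mathcal{A}$. Optimal active sets are denoted $\mathcal{A}_i$, with complements $\mathcal{N}_i$. Standing assumption (LICQ): $G_{\mathcal{A}_i}$ has full row rank. Parametric solution for $\mathcal{A}_i$: the affine functions $\lambda^*(\theta)=\tilde q_i+\tilde Q_i\theta$ and $z^*(\theta)=k_i+K_i\theta$,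 where $\tilde q_i\in\mathbb{R}^p$, $\tilde Q_i\in\mathbb{R}^{p\times n}$ satisfy $\tilde q_{i,\mathcal{N}_i}=0$, $\tilde Q_{i,\mathcal{N}_i}=0$, $$\tilde q_{i,\mathcal{A}_i}=-(G_{\mathcal{A}_i}H^{-1}G_{\mathcal{A}_i}^T)^{-1}b_{\mathcal{A}_i},\qquad \tilde Q_{i,\mathcal{A}_i}=-(G_{\mathcal{A}_i}H^{-1}G_{\mathcal{A}_i}^T)^{-1}S_{\mathcal{A}_i},$$ and $k_i=-H^{-1}G_{\mathcal{A}_i}^T\tilde q_{i,\mathcal{A}_i}\in\mathbb{R}^m$, $K_i=-H^{-1}G_{\mathcal{A}_i}^T\tilde Q_{i,\mathcal{A}_i}\in\mathbb{R}^{m\times n}$. (This is the primal-dual solution of minimizing $\frac12z^THz$ subject to $G_{\mathcal{A}_i}z=b_{\mathcal{A}_i}+S_{\mathcal{A}_i}\theta$, and it solves the mpQP for $\theta$ in the critical region of $\mathcal{A}_i$.) When $\mathcal{A}_i=\emptyset$, all these quantities are zero. *)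

(* Defs.v *)
From HB Require Import structures.
From mathcomp Require Import all_boot all_order all_algebra.
From mathcomp Require Import reals.

Set Implicit Arguments.
Unset Strict Implicit.
Unset Printing Implicit Defensive.

Import Order.TTheory GRing.Theory Num.Theory.
Local Open Scope ring_scope.

Definition vle (R : realType) (k : nat) (x y : 'cV[R]_k) : Prop :=
  forall i, x i 0 <= y i 0.

Definition posdefmx (R : realType) (m : nat) (H : 'M[R]_m) : Prop :=
  H^T = H /\ forall z : 'cV[R]_m, z != 0 -> 0 < (z^T *m H *m z) 0 0.

Definition polyhedral (R : realType) (n : nat) (X : 'cV[R]_n -> Prop) : Prop :=
  exists (r : nat) (E : 'M[R]_(r, n)) (e : 'cV[R]_r),
    forall x, X x <-> vle (E *m x) e.

(* Data of: minimize (1/2) z^T H z over z in R^m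
   subject to G z <= b + S theta, with theta in Theta, a subset of R^n. *)
Record mpQP (R : realType) (n m p : nat) := MpQP {
  qpH : 'M[R]_m;
  qpG : 'M[R]_(p, m);
  qpb : 'cV[R]_p;
  qpS : 'M[R]_(p, n);
  qpTheta : 'cV[R]_n -> Prop;
  qpH_posdef : posdefmx qpH;
  qpTheta_polyhedral : polyhedral qpTheta }.

(* M_I: the rows of M with index in I, in increasing order. *)
Definition rows (R : realType) (p k : nat) (I : {set 'I_p})
    (M : 'M[R]_(p, k)) : 'M[R]_(#|I|, k) :=
  rowsub (fun s : 'I_#|I| => enum_val s) M.

(* Left multiplication by the transposed selection matrix of I; the result is
   the matrix whose rows in I are those of X and whose other rows vanish, see
   rows_zero_pad and zero_pad_notin. *)
Definition zero_pad (R : realType) (p k : nat) (I : {set 'I_p})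
    (X : 'M[R]_(#|I|, k)) : 'M[R]_(p, k) :=
  (rows I 1%:M)^T *m X.

Lemma rows_zero_pad (R : realType) (p k : nat) (I : {set 'I_p})
  (X : 'M[R]_(#|I|, k)) : rows I (zero_pad X) = X.
Proof.
apply/matrixP => s j; rewrite !mxE (bigD1 s) //= !mxE eqxx mul1r.
rewrite big1 ?addr0 // => t ts.
by rewrite !mxE (inj_eq enum_val_inj) (negbTE ts) mul0r.
Qed.

Lemma zero_pad_notin (R : realType) (p k : nat) (I : {set 'I_p})
  (X : 'M[R]_(#|I|, k)) (i : 'I_p) (j : 'I_k) :
  i \notin I -> zero_pad X i j = 0.
Proof.
move=> iI; rewrite !mxE big1 // => t _; rewrite !mxE.
case: eqP => [ti|_]; last by rewrite mul0r.
by move: iI; rewrite -ti enum_valP.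
Qed.

Section MpQPTheory.
Variables (R : realType) (n m p : nat) (P : mpQP R n m p).

Local Notation H := (qpH P).
Local Notation G := (qpG P).
Local Notation b := (qpb P).
Local Notation S := (qpS P).

Definition qp_cost (z : 'cV[R]_m) : R := 2^-1 * (z^T *m H *m z) 0 0.

Definition qp_feasible (theta : 'cV[R]_n) (z : 'cV[R]_m) : Prop :=
  vle (G *m z) (b + S *m theta).

Definition qp_optimal (theta : 'cV[R]_n) (z : 'cV[R]_m) : Prop :=
  qp_feasible theta z /\
  forall z', qp_feasible theta z' -> qp_cost z <= qp_cost z'.

Definition KKT (theta : 'cV[R]_n) (z : 'cV[R]_m) (lambda : 'cV[R]_p) : Prop :=
  [/\ H *m z + G^T *m lambda = 0,
      vle (G *m z) (b + S *m theta),
      vle 0 lambda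
    & forall i, lambda i 0 * (G *m z - b - S *m theta) i 0 = 0].

Definition active_set (theta : 'cV[R]_n) (z : 'cV[R]_m) : {set 'I_p} :=
  [set i | (G *m z) i 0 == (b + S *m theta) i 0].

(* The last clause says that no constraint in A is weakly active. *)
Definition optimal_active_set (A : {set 'I_p}) : Prop :=
  exists (theta : 'cV[R]_n) (z : 'cV[R]_m) (lambda : 'cV[R]_p),
    [/\ qpTheta P theta, qp_optimal theta z, KKT theta z lambda,
        A = active_set theta z
      & forall i, i \in A -> lambda i 0 != 0].

(* The coefficients of the parametric solution for A,
   lambda(theta) = qtilde A + Qtilde A *m theta and
   z(theta) = kvec A + Kmx A *m theta. *)
Definition schur_mx (A : {set 'I_p}) : 'M[R]_#|A| :=
  rows A G *m invmx H *m (rows A G)^T.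

Definition qtilde (A : {set 'I_p}) : 'cV[R]_p :=
  zero_pad (- (invmx (schur_mx A) *m rows A b)).

Definition Qtilde (A : {set 'I_p}) : 'M[R]_(p, n) :=
  zero_pad (- (invmx (schur_mx A) *m rows A S)).

Definition kvec (A : {set 'I_p}) : 'cV[R]_m :=
  - (invmx H *m (rows A G)^T *m rows A (qtilde A)).

Definition Kmx (A : {set 'I_p}) : 'M[R]_(m, n) :=
  - (invmx H *m (rows A G)^T *m rows A (Qtilde A)).

End MpQPTheory.

(* Main.v *)
Require Import Defs.
From mathcomp Require Import all_boot all_order all_algebra.
From mathcomp Require Import reals.
Import Order.TTheory.
Import GRing.Theory Num.Theory.
Local Open Scope ring_scope.

Set Implicit Arguments.
Unset Strict Implicit.
Unset Printing Implicit Defensive.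

(** Put [M = G H^-1 G^T]. For a right-hand side [B] (either [b] or [S]), the
    multiplier block [X_A] of the active set [A] is the unique matrix supported
    on the rows in [A] with [(M X_A + B)_A = 0]. Let [d] be supported on
    [Aj = Ai + l], with [d_l = -1] and [(M d)_Ai = 0]. Then [X_Ai - d x], where
    [x] is row [l] of [X_Aj], agrees with [X_Aj] in row [l] and satisfies the
    equations indexed by [Ai], so uniqueness for [Ai] gives
    [X_Aj = X_Ai - d x]. The primal coefficients are the image of the
    multiplier coefficients under [- H^-1 G^T]. *)

Lemma rowsE (R : realType) (p k : nat) (A : {set 'I_p}) (M : 'M[R]_(p, k)) :
  rows A M = rows A 1%:M *m M.
Proof. by rewrite /rows mul_rowsub_mx mul1mx. Qed.

Lemma zero_pad_rows (R : realType) (p k : nat) (A : {set 'I_p})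
    (M : 'M[R]_(p, k)) :
  (forall i, i \notin A -> forall j, M i j = 0) -> zero_pad (rows A M) = M.
Proof.
move=> M0; apply/matrixP => i j.
have [iA|iA] := boolP (i \in A); last by rewrite zero_pad_notin ?M0.
have := congr1 (fun X : 'M_(_, _) => X (enum_rank_in iA i) j)
  (rows_zero_pad (rows A M)).
by rewrite !mxE enum_rankK_in.
Qed.

Lemma posdefmx_unit (R : realType) (m : nat) (H : 'M[R]_m) :
  posdefmx H -> H \in unitmx.
Proof.
case=> _ Hpos; rewrite -row_free_unit; apply: inj_row_free => v vH0.
apply/eqP; apply: contraT => v0.
have := Hpos v^T; rewrite trmxK vH0 mul0mx mxE ltxx => -> //.
by apply: contra v0 => /eqP/(congr1 trmx); rewrite trmxK trmx0 => ->.
Qed.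

(** If [u] kills the product on the left, then [z = (u F H^-1)^T] satisfies
    [z^T H z = (u F H^-1 F^T) u^T = 0], so [z = 0]; then [u F = z^T H = 0] and row freeness gives
    [u = 0]. *)
Lemma posdefmx_congr_unit (R : realType) (m k : nat) (H : 'M[R]_m)
    (F : 'M[R]_(k, m)) :
  posdefmx H -> row_free F -> F *m invmx H *m F^T \in unitmx.
Proof.
move=> Hpd Ffree; have Hu := posdefmx_unit Hpd; have [Hsym Hpos] := Hpd.
rewrite -row_free_unit; apply: inj_row_free => u uS0.
pose z := (u *m F *m invmx H)^T.
have uFE : u *m F = z^T *m H by rewrite trmxK mulmxKV.
have z0 : z = 0.
  apply/eqP; apply: contraT => /Hpos.
  have -> : z^T *m H *m z = 0; last by rewrite mxE ltxx.
  rewrite -uFE /z !trmx_mul trmx_inv Hsym.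
  by rewrite !mulmxA in uS0 *; rewrite uS0 mul0mx.
by apply: (row_free_inj Ffree); rewrite uFE z0 trmx0 !mul0mx.
Qed.

Section PaddedSolution.
Variables (R : realType) (p : nat) (M : 'M[R]_p).
Implicit Type A : {set 'I_p}.

(** The principal block of [M] on [A] is written with selection matrices, and [k] is left free so
    that [b] and [S] are treated at once. *)
Definition padded_sol k A (B : 'M[R]_(p, k)) : 'M[R]_(p, k) :=
  zero_pad (- (invmx (rows A 1%:M *m M *m (rows A 1%:M)^T) *m rows A B)).

Lemma padded_sol_rows k A (B : 'M[R]_(p, k)) :
    rows A 1%:M *m M *m (rows A 1%:M)^T \in unitmx ->
  rows A (M *m padded_sol A B) = - rows A B.
Proof.
move=> Mu; rewrite rowsE /padded_sol /zero_pad !mulmxA.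
by rewrite mulmxN mulKVmx.
Qed.

(** For [X] supported on [A], the rows in [A] of [M X] are the invertible principal block times
    [rows A X]. *)
Lemma supported_ker_eq0 k A (X : 'M[R]_(p, k)) :
    rows A 1%:M *m M *m (rows A 1%:M)^T \in unitmx ->
    (forall i, i \notin A -> forall j, X i j = 0) ->
  rows A (M *m X) = 0 -> X = 0.
Proof.
move=> Mu /zero_pad_rows XE MX0; rewrite -XE.
suff -> : rows A X = 0 by rewrite /zero_pad mulmx0.
apply: (can_inj (mulKmx Mu)).
by rewrite mulmx0 -MX0 -{2}XE [RHS]rowsE /zero_pad !mulmxA.
Qed.

Lemma padded_sol_update A l :
    l \notin A ->
    rows A 1%:M *m M *m (rows A 1%:M)^T \in unitmx ->
    rows (A :|: [set l]) 1%:M *m M *m (rows (A :|: [set l]) 1%:M)^T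
      \in unitmx ->
  exists d : 'cV[R]_p,
    [/\ forall i, i \notin A :|: [set l] -> d i 0 = 0,
        d l 0 = -1
      & forall k (B : 'M[R]_(p, k)),
          padded_sol (A :|: [set l]) B =
          padded_sol A B - d *m row l (padded_sol (A :|: [set l]) B)].
Proof.
(* The padded term cancels [M e] on the rows in [A] and vanishes at [l], so [e] alone fixes
   [d l 0]. *)
move=> lA Au Alu; pose e : 'cV[R]_p := delta_mx l 0.
pose d := - (e + padded_sol A (M *m e)).
have dout i : i \notin A :|: [set l] -> d i 0 = 0.
  rewrite !inE negb_or => /andP[iA il].
  rewrite /d /e mxE [X in - X]mxE zero_pad_notin // mxE (negbTE il).
  by rewrite addr0 oppr0.
have dl : d l 0 = -1.
  by rewrite /d /e mxE [X in - X]mxE zero_pad_notin // mxE !eqxx addr0.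
have rowsMd : rows A (M *m d) = 0.
  rewrite rowsE mulmxN mulmxDr mulmxN mulmxDr -!rowsE padded_sol_rows //.
  by rewrite subrr oppr0.
exists d; split=> // k B.
set Xj := padded_sol _ B; set Xi := padded_sol A B.
apply/eqP; rewrite -subr_eq0; apply/eqP.
apply: (supported_ker_eq0 (A := A)) => //.
  (* Support of the difference: row [l] cancels because [d l 0 = -1]; every other row outside [A] is
     zero in each term. *)
  move=> i iA j.
  rewrite [LHS]mxE [X in _ + X]mxE [X in _ - X]mxE.
  rewrite [Xi i j]zero_pad_notin // add0r.
  rewrite [X in _ - X]mxE opprK [X in _ + X]mxE big_ord1 [X in _ * X]mxE.
  have [->|il] := eqVneq i l; first by rewrite dl mulN1r subrr.
  have iAl : i \notin A :|: [set l] by rewrite !inE negb_or iA.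
  by rewrite dout // mul0r addr0 zero_pad_notin.
(* [Xj] solves the equations of the larger set; those indexed by [A] are among them, up to
   renumbering positions. *)
have rowsXj : rows A (M *m Xj) = - rows A B.
  apply/matrixP => s j; have sAl : enum_val s \in A :|: [set l].
    by rewrite inE enum_valP.
  have := congr1 (fun X : 'M_(_, _) => X (enum_rank_in sAl (enum_val s)) j)
    (padded_sol_rows B Alu).
  by rewrite !mxE enum_rankK_in // => ->.
rewrite 2!mulmxBr (mulmxA M d) rowsE 2!mulmxBr -!rowsE rowsXj.
rewrite padded_sol_rows //.
by rewrite [rows A (_ *m _)]rowsE mulmxA -rowsE rowsMd mul0mx subr0 subrr.
Qed.

End PaddedSolution.

Section ParametricSolution.
Variables (R : realType) (n m p : nat) (P : mpQP R n m p).
Local Notation M := (qpG P *m invmx (qpH P) *m (qpG P)^T).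
Implicit Type A : {set 'I_p}.

Lemma schur_mxE A :
  schur_mx P A = rows A 1%:M *m M *m (rows A 1%:M)^T.
Proof. by rewrite /schur_mx rowsE trmx_mul !mulmxA. Qed.

Lemma schur_mx_unit A :
  row_free (rows A (qpG P)) -> schur_mx P A \in unitmx.
Proof. exact/posdefmx_congr_unit/qpH_posdef. Qed.

Lemma qtildeE A : qtilde P A = padded_sol M A (qpb P).
Proof. by rewrite /qtilde schur_mxE. Qed.

Lemma QtildeE A : Qtilde P A = padded_sol M A (qpS P).
Proof. by rewrite /Qtilde schur_mxE. Qed.

(** This makes the map from multipliers to primal variables independent of the active set. *)
Lemma tr_rows_mul_zero_pad k A (F : 'M[R]_(p, m)) (X : 'M[R]_(#|A|, k)) :
  (rows A F)^T *m X = F^T *m zero_pad X.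
Proof. by rewrite rowsE trmx_mul mulmxA. Qed.

Lemma kvecE A : kvec P A = - (invmx (qpH P) *m (qpG P)^T *m qtilde P A).
Proof.
by rewrite /kvec rows_zero_pad -!mulmxA tr_rows_mul_zero_pad.
Qed.

Lemma KmxE A : Kmx P A = - (invmx (qpH P) *m (qpG P)^T *m Qtilde P A).
Proof.
by rewrite /Kmx rows_zero_pad -!mulmxA tr_rows_mul_zero_pad.
Qed.

Lemma primal_of_dual A (theta : 'cV[R]_n) :
  kvec P A + Kmx P A *m theta =
  - (invmx (qpH P) *m (qpG P)^T *m (qtilde P A + Qtilde P A *m theta)).
Proof. by rewrite kvecE KmxE mulmxDr opprD mulNmx !mulmxA. Qed.

End ParametricSolution.

Lemma affine_update (R : realType) (n p : nat) (l : 'I_p) (q q' d : 'cV[R]_p)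
    (Q Q' : 'M[R]_(p, n)) (theta : 'cV[R]_n) :
    q' = q - d *m row l q' -> Q' = Q - d *m row l Q' ->
  q' + Q' *m theta =
  q + Q *m theta - (q' l 0 + (row l Q' *m theta) 0 0) *: d.
Proof.
move=> q'E Q'E; rewrite {1}q'E {1}Q'E mulmxBl addrACA -opprD; congr (_ - _).
rewrite -mulmxA -mulmxDr [row l q' + _]mx11_scalar mul_mx_scalar.
by rewrite mxE [row l q' 0 0]mxE.
Qed.

Theorem theorem1 (R : realType) (n m p : nat) (P : mpQP R n m p)
    (Ai Aj : {set 'I_p}) (l : 'I_p)
    (hAi : optimal_active_set P Ai)
    (hl : l \in ~: Ai)
    (hAij : Aj = Ai :|: [set l])
    (hAj : optimal_active_set P Aj)
    (hGi : row_free (rows Ai (qpG P)))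
    (hGj : row_free (rows Aj (qpG P))) :
  exists (c : R) (v : 'cV[R]_n) (f : 'cV[R]_m) (d : 'cV[R]_p),
    [/\ forall i, i \in ~: Aj -> d i 0 = 0,
        d l 0 = -1,
        forall theta : 'cV[R]_n,
          qtilde P Aj + Qtilde P Aj *m theta =
          qtilde P Ai + Qtilde P Ai *m theta - (c + (v^T *m theta) 0 0) *: d
      & forall theta : 'cV[R]_n,
          kvec P Aj + Kmx P Aj *m theta =
          kvec P Ai + Kmx P Ai *m theta + (c + (v^T *m theta) 0 0) *: f].
Proof.
have lAi : l \notin Ai by rewrite inE in hl.
have := schur_mx_unit hGi; have := schur_mx_unit hGj.
rewrite !schur_mxE hAij => Aju Aiu.
have [d [dout dl upd]] := padded_sol_update lAi Aiu Aju.
rewrite -hAij in dout upd *.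
(* The scalar [c + v^T theta] is the multiplier of constraint [l] in the solution for [Aj]. *)
pose c := qtilde P Aj l 0; pose v := (row l (Qtilde P Aj))^T.
have dual (theta : 'cV[R]_n) : qtilde P Aj + Qtilde P Aj *m theta =
    qtilde P Ai + Qtilde P Ai *m theta - (c + (v^T *m theta) 0 0) *: d.
  by rewrite /v trmxK; apply: affine_update;
    rewrite ?qtildeE ?QtildeE; apply: upd.
exists c, v, (invmx (qpH P) *m (qpG P)^T *m d), d; split=> //.
  by move=> i; rewrite inE => /dout.
move=> theta; rewrite !primal_of_dual dual mulmxBr opprB addrC.
by rewrite -scalemxAr.
Qed.
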